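(* Let $m\ge 0$ be an integer, $1<p<\infty$, and let $\mu_0,\dots,\mu_m$ be positive Borel measures supported on $\mathbb{R}$ such that the support of $\mu_0$ is an infinite set. For polynomials $f$ let $$\|f\|_{S,p,m}=\left(\sum_{k=0}^m\int|f^{(k)}|^p\,d\mu_k\right)^{1/p}.$$ Let $L_n$ be a monic polynomial of degree $n$. Then $L_n$ is the $n$th monic extremal polynomial relative to $\|\cdot\|_{S,p,m}$ if and only if $$\sum_{k=0}^m\int Q^{(k)}\,\operatorname{sgn}\big(L_n^{(k)}\big)\,\big|L_n^{(k)}\big|^{p-1}\,d\mu_k=0$$ for every polynomial $Q\in\mathbb{P}_{n-1}$.
   Context: $\mathbb{P}_{n}$ is the space of polynomials with complex coefficients of degree at most $n$. $\operatorname{sgn}(y)=y/|y|$ if $y\neq0$ and $\operatorname{sgn}(0)=0$. $f^{(k)}$ denotes the $k$th derivative. It is assumed that all polynomials belong to $L^p(\mu_k)$ for $k=0,\dots,m$, so that $\|\cdot\|_{S,p,m}$ is a (finite) norm on polynomials. The $n$th monic extremal polynomial relative to $\|\cdot\|_{S,p,m}$ is the unique monic polynomial of exact degree $n$ minimizing $\|Q\|_{S,p,m}$ among all monic polynomials $Q$ of degree $n$. *)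

(* Defs.v *)
From HB Require Import structures.
From mathcomp Require Import all_boot all_order all_algebra.
From mathcomp Require Import complex.
From mathcomp Require Import all_classical all_reals all_analysis.

Set Implicit Arguments.
Unset Strict Implicit.
Unset Printing Implicit Defensive.

Import Order.TTheory GRing.Theory Num.Theory.
Import numFieldNormedType.Exports.
Import ComplexField.Normc.

Local Open Scope classical_set_scope.
Local Open Scope ring_scope.
Local Open Scope complex_scope.

(* A Borel measure on the real line. [measurableTypeR R] carries the Borel
   sigma-algebra (generated by the half-open intervals). *)
Notation borel_measure R := {measure set (measurableTypeR R) -> \bar R}.

Definition measure_support (R : realType) (mu : borel_measure R) : set R :=
  [set x | forall U : set R, open U -> U x -> (0 < mu U)%E].

Definition csgn (R : realType) (y : R[i]) : R[i] :=
  if y == 0 then 0 else y / (normc y)%:C.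

Definition Cintegral (R : realType) (mu : borel_measure R) (f : R -> R[i]) :
    R[i] :=
  (\int[mu]_x complex.Re (f x)) +i* (\int[mu]_x complex.Im (f x)).

(* Complex polynomials are evaluated at real points only. *)
Definition evalR (R : realType) (f : {poly R[i]}) (x : R) : R[i] := f.[x%:C].

Definition poly_in_Lp (R : realType) (p : R) (mu : borel_measure R)
    (f : {poly R[i]}) : Prop :=
  (fun x : measurableTypeR R => normc (evalR f x)) \in Lfun mu p%:E.

(* [Rintegral] is 0 by convention on divergent integrals, so this is the
   intended norm only on polynomials whose derivatives are in L^p. *)
Definition sobolev_norm (R : realType) (m : nat) (p : R)
    (mu : 'I_m.+1 -> borel_measure R) (f : {poly R[i]}) : R :=
  (\sum_(k < m.+1) \int[mu k]_x (normc (evalR (derivn k f) x) `^ p)) `^ p^-1.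

Definition monic_of_degree (R : realType) (n : nat) (Q : {poly R[i]}) : Prop :=
  Q \is monic /\ size Q = n.+1.

Definition monic_minimizer (R : realType) (m : nat) (p : R)
    (mu : 'I_m.+1 -> borel_measure R) (n : nat) (L : {poly R[i]}) : Prop :=
  monic_of_degree n L /\
  forall Q, monic_of_degree n Q -> sobolev_norm p mu L <= sobolev_norm p mu Q.

(* [unique P L] says that L satisfies P and is the only polynomial to do so. *)
Definition monic_extremal (R : realType) (m : nat) (p : R)
    (mu : 'I_m.+1 -> borel_measure R) (n : nat) (L : {poly R[i]}) : Prop :=
  unique (monic_minimizer p mu n) L.

(* Main.v *)
(* The functional f |-> ||f||^p is strictly convex on polynomials: for
   complex numbers |a + b|^p >= |a|^p + p |a|^(p-2) Re (a conj b), with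
   equality only for b = 0, and a polynomial vanishing mu_0-almost
   everywhere is 0 because the support of mu_0 is infinite. Hence the
   vanishing of the derivative at L along all Q of degree < n implies that
   L is the unique minimizer. Conversely, the tangent inequality at L + tQ
   gives a nonnegative derivative there along Q for t > 0, and dominated
   convergence lets t tend to 0. The orthogonality relations, which carry
   no complex conjugate, express the vanishing of the derivative along the
   polynomials with conjugate coefficients, as all measures live on R. *)

Require Import Defs.
From HB Require Import structures.
From mathcomp Require Import all_boot all_order all_algebra.
From mathcomp Require Import complex.
From mathcomp Require Import all_classical all_reals all_analysis.
From mathcomp Require Import measurable_realfun ring lra.
Import Order.TTheory GRing.Theory Num.Theory.
Import numFieldNormedType.Exports.
Import ComplexField.Normc.
Local Open Scope classical_set_scope.
Local Open Scope ring_scope.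
Local Open Scope complex_scope.

(** * Tangent inequality for real powers *)

(* With u = ln (b / a), dividing by a^(p-1) b turns the inequality into
   exp ((p-1) u) + (p-1) exp (-u) >= p, a sum of two tangent inequalities for
   exp at 0. *)
Lemma powR_tangent_lt {R : realType} {p a b : R} : 1 < p -> 0 <= a -> 0 <= b ->
  a != b -> p * a `^ (p - 1) * b < b `^ p + (p - 1) * a `^ p.
Proof.
move=> p1 a0 b0 ab.
have p0 : p != 0 by lra.
have p10 : p - 1 != 0 by lra.
have [a_eq0|an0] := eqVneq a 0.
  rewrite a_eq0 !powR0// !(mulr0, mul0r) addr0 powR_gt0//.
  by rewrite lt_def b0 andbT -a_eq0 eq_sym.
have ap : 0 < a by rewrite lt_def an0.
have [->|bn0] := eqVneq b 0.
  by rewrite mulr0 powR0// add0r mulr_gt0 ?powR_gt0//; lra.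
have bp : 0 < b by rewrite lt_def bn0.
pose u := ln b - ln a.
have un0 : u != 0.
  by rewrite subr_eq0; apply: contra_neq ab => /ln_inj ->; rewrite ?posrE.
have h : p < expR ((p - 1) * u) + (p - 1) * expR (- u).
  have /expR_gt1Dx h1 : (p - 1) * u != 0 by rewrite mulf_neq0.
  have : (p - 1) * (1 + - u) <= (p - 1) * expR (- u).
    by rewrite ler_wpM2l ?expR_ge1Dx//; lra.
  lra.
have c0 : 0 < a `^ (p - 1) * b by rewrite mulr_gt0 ?powR_gt0.
have := h; rewrite -(ltr_pM2r c0) mulrA => /lt_le_trans; apply.
rewrite le_eqVlt; apply/orP; left; apply/eqP.
rewrite mulrDl /powR !(gt_eqF ap) !(gt_eqF bp) /u.
rewrite -[in LHS](lnK (x := b)) ?posrE// -!mulrA -!expRD.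
by congr (expR _ + _ * expR _); rewrite ?expRK; ring.
Qed.

(** Young's inequality for conjugate exponents; a = b is its case of equality. *)
Lemma powR_tangent {R : realType} {p a b : R} : 1 < p -> 0 <= a -> 0 <= b ->
  p * a `^ (p - 1) * b <= b `^ p + (p - 1) * a `^ p.
Proof.
move=> p1 a0 b0; have [<-|/powR_tangent_lt/ltW] := eqVneq a b; last exact.
rewrite -mulrA [a `^ (p - 1) * a]mulrC mulr_powRB1//; last lra.
by rewrite le_eqVlt; apply/orP; left; apply/eqP; ring.
Qed.

(** * The modulus of complex numbers *)

Lemma normc_ge0 {R : realType} (a : R[i]) : 0 <= normc a.
Proof. by case: a => x y; exact: sqrtr_ge0. Qed.

Lemma sqr_normc {R : realType} (a : R[i]) :
  normc a ^+ 2 = complex.Re (a * a^*%C).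
Proof.
by case: a => x y; simpc => /=; rewrite sqr_sqrtr ?addr_ge0 ?sqr_ge0.
Qed.

Lemma normc_conjc {R : realType} (a : R[i]) : normc a^*%C = normc a.
Proof. by case: a => x y /=; rewrite sqrrN. Qed.

Lemma normcZ {R : realType} (t : R) (a : R[i]) :
  normc (t%:C * a) = `|t| * normc a.
Proof. by rewrite normcM /= expr0n addr0 sqrtr_sqr. Qed.

Lemma normc_eq0 {R : realType} (a : R[i]) : (normc a == 0) = (a == 0).
Proof.
by apply/eqP/eqP => [/eq0_normc//|->]; rewrite normc0.
Qed.

Lemma Re_le_normc {R : realType} (a : R[i]) : `|complex.Re a| <= normc a.
Proof.
by case: a => x y /=; rewrite -sqrtr_sqr ler_wsqrtr// lerDl sqr_ge0.
Qed.

(** * Directional derivative of the p-th power of the modulus *)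

(* [p * lp_deriv p a b] is the derivative at [a], in the direction [b], of
   [fun z => normc z `^ p] on the real plane. *)
Definition lp_deriv {R : realType} (p : R) (a b : R[i]) : R :=
  normc a `^ (p - 2) * complex.Re (a * b^*%C).

Lemma lp_deriv0l {R : realType} (p : R) (b : R[i]) : lp_deriv p 0 b = 0.
Proof. by rewrite /lp_deriv mul0r mulr0. Qed.

Lemma lp_derivZ {R : realType} (p t : R) (a b : R[i]) :
  lp_deriv p a (t%:C * b) = t * lp_deriv p a b.
Proof.
rewrite /lp_deriv mulrCA; congr (_ * _).
by case: a b => [x y] [z w]; simpc => /=; ring.
Qed.

Lemma lp_derivD {R : realType} (p : R) (a b c : R[i]) :
  lp_deriv p a (b + c) = lp_deriv p a b + lp_deriv p a c.
Proof.
rewrite /lp_deriv -mulrDr; congr (_ * _).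
by case: a b c => [x y] [z w] [s t]; simpc => /=; ring.
Qed.

Lemma lp_deriv_self {R : realType} {p : R} (p1 : 1 < p) (a : R[i]) :
  lp_deriv p a a = normc a `^ p.
Proof.
have [->|a0] := eqVneq a 0; first by rewrite lp_deriv0l normc0 powR0//; lra.
rewrite /lp_deriv -sqr_normc -powR_mulrn ?normc_ge0//.
rewrite -powRD ?normc_eq0 ?a0 ?implybT//.
by congr (_ `^ _); ring.
Qed.

Lemma lp_deriv_le {R : realType} {p : R} (p1 : 1 < p) (a b : R[i]) :
  `|lp_deriv p a b| <= normc a `^ (p - 1) * normc b.
Proof.
have [->|a0] := eqVneq a 0.
  by rewrite lp_deriv0l normr0 mulr_ge0 ?powR_ge0 ?normc_ge0.
rewrite /lp_deriv normrM ger0_norm ?powR_ge0//.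
apply: (@le_trans _ _ (normc a `^ (p - 2) * (normc a * normc b))).
  by rewrite ler_wpM2l ?powR_ge0// -(normc_conjc b) -normcM Re_le_normc.
rewrite mulrA -{2}(powRr1 (normc_ge0 a)) -powRD ?normc_eq0 ?a0 ?implybT//.
by rewrite le_eqVlt; apply/orP; left; apply/eqP; congr (_ `^ _ * _); ring.
Qed.

(** By Young's inequality; the bound supplies integrable majorants for [lp_deriv]. *)
Lemma lp_deriv_leD {R : realType} {p : R} (p1 : 1 < p) (a b : R[i]) :
  `|lp_deriv p a b| <= normc a `^ p + normc b `^ p.
Proof.
apply: le_trans (lp_deriv_le p1 a b) _.
have := powR_tangent p1 (normc_ge0 a) (normc_ge0 b).
have := powR_ge0 (normc a) p; have := powR_ge0 (normc b) p.
move: (normc a `^ p) (normc b `^ p) (_ `^ (p - 1)) => x y z x0 y0 h.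
rewrite -(@ler_pM2l _ p); last lra.
by rewrite mulrA (le_trans h)//; nra.
Qed.

(** In the direction a + b the derivative is |a|^p plus that along b, and it is at most |a|^(p-1) |a
    + b|; the real tangent inequality at |a| bounds the latter. *)
Lemma lp_deriv_tangent {R : realType} {p : R} (p1 : 1 < p) (a b : R[i]) :
  normc a `^ p + p * lp_deriv p a b <= normc (a + b) `^ p.
Proof.
have := powR_tangent p1 (normc_ge0 a) (normc_ge0 (a + b)).
have := lp_deriv_le p1 a (a + b); rewrite lp_derivD lp_deriv_self// => h.
rewrite -mulrA => k; have := le_trans (ler_norm _) h.
by rewrite -(@ler_pM2l _ p); [lra|lra].
Qed.

(** Equality forces |a + b| = |a| by strictness of the real inequality. Then the derivative along b
    is 0, so b is orthogonal to a in the plane, and Pythagoras gives b = 0. *)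
Lemma lp_deriv_tangent_eq {R : realType} {p : R} (p1 : 1 < p) (a b : R[i]) :
  normc (a + b) `^ p = normc a `^ p + p * lp_deriv p a b -> b = 0.
Proof.
move=> e.
have h := le_trans (ler_norm _) (lp_deriv_le p1 a (a + b)).
have ab : normc a = normc (a + b).
  apply/eqP; apply: contraPT isT.
  move=> /(powR_tangent_lt p1 (normc_ge0 a) (normc_ge0 (a + b))).
  move: h; rewrite lp_derivD lp_deriv_self//.
  rewrite -(@ler_pM2l _ p); last lra.
  by rewrite -mulrA; lra.
have [a0|a0] := eqVneq a 0.
  by move: ab; rewrite a0 add0r normc0 => /esym/eq0_normc.
have q0 : 0 < normc a `^ (p - 2).
  by rewrite powR_gt0// lt_def normc_eq0 a0 normc_ge0.
have e0 : lp_deriv p a b = 0.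
  move: e; rewrite -ab => e.
  by apply/eqP; rewrite -(mulrI_eq0 _ (@lregP _ p _)); [apply/eqP; lra|lra].
have r0 : complex.Re (a * b^*%C) = 0.
  by apply/eqP; move/eqP: e0; rewrite mulf_eq0 (gt_eqF q0).
have : normc (a + b) ^+ 2 =
    normc a ^+ 2 + normc b ^+ 2 + complex.Re (a * b^*%C) *+ 2.
  by rewrite !sqr_normc; case: (a) (b) => [x y] [z t]; simpc => /=; ring.
rewrite -ab r0 => s; apply/eq0_normc/eqP; rewrite -sqrf_eq0; apply/eqP; lra.
Qed.

Lemma lp_deriv_cvg {R : realType} {p : R} (p1 : 1 < p) (a b : R[i]) :
  lp_deriv p (a + t%:C * b) b @[t --> 0^'+] --> lp_deriv p a b.
Proof.
have p0 : 0 < p by lra.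
have [->|a0] := eqVneq a 0.
  rewrite lp_deriv0l.
  apply: (@cvg_trans _ ((t `^ (p - 1) * normc b `^ p) @[t --> 0^'+])).
    apply: near_eq_cvg; near=> t.
    have t0 : 0 < t by [].
    (* Scaling the direction by t turns the derivative at tb into |tb|^p / t. *)
    rewrite add0r -[RHS](mulKf (lt0r_neq0 t0)) -lp_derivZ.
    rewrite lp_deriv_self// normcZ gtr0_norm// powRM ?(ltW t0) ?normc_ge0//.
    by rewrite mulrA -[t `^ p](mulr_powRB1 (ltW t0))// mulKf ?lt0r_neq0.
  suff : t `^ (p - 1) * normc b `^ p @[t --> 0^'+] --> 0 * normc b `^ p.
    by rewrite mul0r.
  by apply: cvgM (cvg_cst _); apply: powR_cvg0; lra.
pose s t := normc (a + t%:C * b).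
have ncE t : s t = Num.sqrt
    ((complex.Re a + t * complex.Re b) ^+ 2 +
     (complex.Im a + t * complex.Im b) ^+ 2).
  by rewrite /s; case: (a) (b) => [x y] [z w]; simpc.
have cs : s t @[t --> 0] --> normc a.
  have -> : normc a = s 0 by rewrite /s mul0r addr0.
  rewrite (funext ncE).
  pose q t := (complex.Re a + t * complex.Re b) ^+ 2 +
     (complex.Im a + t * complex.Im b) ^+ 2.
  apply: (@continuous_comp _ _ _ q (@Num.sqrt R) 0);
    last exact: sqrt_continuous.
  apply: cvgD; apply: cvgM; apply: cvgD; (try exact: cvg_cst);
  by apply: cvgM; [exact: cvg_id|exact: cvg_cst].
(* For a nonzero even the two-sided limit holds, since the real power is differentiable at |a| >
   0. *)
apply: cvg_at_right_filter; rewrite /lp_deriv; apply: cvgM.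
  apply: (@cvg_comp _ _ _ s (@powR R ^~ (p - 2)) _ _ _ cs).
  suff /derivable1_diffP/differentiable_continuous :
    derivable (@powR R ^~ (p - 2)) (normc a) 1 by exact.
  by apply: derivable_powR;
    rewrite in_itv/= andbT lt_def normc_eq0 a0 normc_ge0.
have -> : complex.Re (a * b^*%C) =
    complex.Re (a * b^*%C) + 0 * complex.Re (b * b^*%C).
  by rewrite mul0r addr0.
have h t : complex.Re ((a + t%:C * b) * b^*%C) =
   complex.Re (a * b^*%C) + t * complex.Re (b * b^*%C).
  by case: (a) (b) => [x y] [z w]; simpc => /=; ring.
under eq_cvg do rewrite h.
by apply: cvgD; [exact: cvg_cst|apply: cvgM; [exact: cvg_id|exact: cvg_cst]].
Unshelve. all: by end_near. Qed.

(** * Complex polynomials on the real line *)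

(** Reduces measurability and continuity questions to polynomials with real coefficients. *)
Lemma evalR_reim {R : realType} (f : {poly R[i]}) :
  exists g h : {poly R}, forall x, evalR f x = g.[x] +i* h.[x].
Proof.
elim/poly_ind: f => [|f [u v] [g [h fE]]].
  by exists 0, 0 => x; rewrite /evalR !horner0.
exists (g * 'X + u%:P), (h * 'X + v%:P) => x.
rewrite /evalR !hornerE [_.[x%:C]]fE; simpc; congr (_ +i* _).
Qed.

Lemma evalRD {R : realType} (f g : {poly R[i]}) x :
  evalR (f + g) x = evalR f x + evalR g x.
Proof. exact: hornerD. Qed.

Lemma evalRZ {R : realType} (c : R[i]) (f : {poly R[i]}) x :
  evalR (c *: f) x = c * evalR f x.
Proof. exact: hornerZ. Qed.

(** Conjugation fixes the real point of evaluation. *)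
Lemma evalR_conj {R : realType} (f : {poly R[i]}) x :
  evalR (map_poly conjc f) x = (evalR f x)^*.
Proof. by rewrite /evalR -{1}(conjc_real x) horner_map. Qed.

(** Since sgn(a) |a|^(p-1) = a |a|^(p-2), the integrand of the orthogonality relation is a
    derivative in the conjugate direction. *)
Lemma Re_csgn {R : realType} {p : R} (a b : R[i]) :
  complex.Re (b^*%C * csgn a * (normc a `^ (p - 1))%:C) = lp_deriv p a b.
Proof.
rewrite /csgn; have [->|a0] := eqVneq a 0.
  by rewrite lp_deriv0l mulr0 mul0r.
have -> : p - 1 = (p - 2) + 1 by ring.
rewrite powRD ?normc_eq0 ?a0 ?implybT// powRr1 ?normc_ge0// rmorphM/=.
have n0 : (normc a)%:C != 0.
  by rewrite fmorph_eq0 normc_eq0.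
rewrite [_%:C * _]mulrC mulrA mulrA divfK//.
rewrite /lp_deriv; case: (a) (b) => [x y] [z w]; simpc => /=; ring.
Qed.

(** * Integration of the tangent inequality and its equality case *)

Lemma measurable_lp_deriv {R : realType} (p : R) (f g : {poly R[i]}) :
  measurable_fun [set: measurableTypeR R]
    (fun x => lp_deriv p (evalR f x) (evalR g x)).
Proof.
have [f1 [f2 fE]] := evalR_reim f; have [g1 [g2 gE]] := evalR_reim g.
have -> : (fun x => lp_deriv p (evalR f x) (evalR g x)) =
    (fun x => Num.sqrt ((f1 ^+ 2 + f2 ^+ 2).[x]) `^ (p - 2) *
              (f1 * g1 + f2 * g2).[x]).
  apply/funext => x; rewrite /lp_deriv fE gE !hornerE /=.
  by congr (_ * _); ring.
apply: measurable_funM; last exact: measurable_poly.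
apply: (measurableT_comp (measurable_powR (p - 2))).
apply: measurableT_comp; last exact: measurable_poly.
by apply: continuous_measurable_fun; exact: sqrt_continuous.
Qed.

Lemma integrable_powR_normc {R : realType} {p : R} {mu : borel_measure R}
    (p1 : 1 < p) (hLp : forall f, poly_in_Lp p mu f) (f : {poly R[i]}) :
  mu.-integrable [set: measurableTypeR R]
    (EFin \o (fun x => normc (evalR f x) `^ p)).
Proof.
have := Lfun_integrable (ltW p1) (hLp f).
by apply: eq_integrable => // x _ /=; rewrite ger0_norm ?normc_ge0.
Qed.

Lemma integrable_lp_deriv {R : realType} {p : R} {mu : borel_measure R}
    (p1 : 1 < p) (hLp : forall f, poly_in_Lp p mu f) (f g : {poly R[i]}) :
  mu.-integrable [set: measurableTypeR R]
    (EFin \o (fun x => lp_deriv p (evalR f x) (evalR g x))).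
Proof.
apply: (le_integrable measurableT _ _ (integrableD measurableT
  (integrable_powR_normc p1 hLp f) (integrable_powR_normc p1 hLp g))).
  by apply/measurable_EFinP; exact: measurable_lp_deriv.
move=> x _; rewrite /= lee_fin.
by rewrite (le_trans (lp_deriv_leD p1 _ _))// ler_norm.
Qed.

Lemma Rintegral_lp_tangent {R : realType} {p : R} {mu : borel_measure R}
    (p1 : 1 < p) (hLp : forall f, poly_in_Lp p mu f) (f g : {poly R[i]}) :
  \int[mu]_x (normc (evalR f x) `^ p) +
    p * (\int[mu]_x lp_deriv p (evalR f x) (evalR g x)) <=
  \int[mu]_x (normc (evalR (f + g) x) `^ p).
Proof.
have iN := integrable_powR_normc p1 hLp.
have iD := integrable_lp_deriv p1 hLp f g.
have ipD : mu.-integrable [set: measurableTypeR R]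
    (EFin \o (fun x => p * lp_deriv p (evalR f x) (evalR g x))).
  exact: (integrableZl measurableT p iD).
rewrite -RintegralZl// -RintegralD//.
apply: le_Rintegral => //; first exact: (integrableD measurableT (iN f) ipD).
by move=> x _; rewrite evalRD lp_deriv_tangent.
Qed.

(** The difference [F] of the two sides is nonnegative with integral 0, hence vanishes almost
    everywhere; the pointwise equality case then applies. *)
Lemma Rintegral_lp_tangent_eq {R : realType} {p : R} {mu : borel_measure R}
    (p1 : 1 < p) (hLp : forall f, poly_in_Lp p mu f) (f g : {poly R[i]}) :
  \int[mu]_x (normc (evalR (f + g) x) `^ p) =
    \int[mu]_x (normc (evalR f x) `^ p) +
    p * (\int[mu]_x lp_deriv p (evalR f x) (evalR g x)) ->
  mu.-negligible [set x : measurableTypeR R | evalR g x != 0].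
Proof.
have iN := integrable_powR_normc p1 hLp.
have iD := integrable_lp_deriv p1 hLp f g.
have ipD : mu.-integrable [set: measurableTypeR R]
    (EFin \o (fun x => p * lp_deriv p (evalR f x) (evalR g x))).
  exact: (integrableZl measurableT p iD).
pose F x := normc (evalR (f + g) x) `^ p -
  (normc (evalR f x) `^ p + p * lp_deriv p (evalR f x) (evalR g x)).
have iT : mu.-integrable [set: measurableTypeR R] (EFin \o
    (fun x => normc (evalR f x) `^ p + p * lp_deriv p (evalR f x) (evalR g x))).
  exact: (integrableD measurableT (iN f) ipD).
have iF : mu.-integrable [set: measurableTypeR R] (EFin \o F).
  exact: (integrableB measurableT (iN (f + g)) iT).
rewrite -RintegralZl// -RintegralD//.
move=> /eqP; rewrite -subr_eq0 -RintegralB//.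
rewrite -/F => /eqP F0.
have Fge0 x : 0 <= F x by rewrite subr_ge0 evalRD lp_deriv_tangent.
have : (\int[mu]_x `|(EFin \o F) x| = 0)%E.
  rewrite -[RHS]/(0%:E) -F0 fineK; last exact: integrable_fin_num.
  by apply: eq_integral => x _ /=; rewrite ger0_norm.
move/ae_eq_integral_abs => /(_ measurableT (measurable_int _ iF)).
apply: negligibleS => x /= gx0 /(_ I) [/eqP]; rewrite subr_eq0 evalRD => /eqP.
by move/(lp_deriv_tangent_eq p1)/eqP; rewrite (negbTE gx0).
Qed.

(** The sum is at most twice the larger term. *)
Lemma powRD_le {R : realType} {p x y : R} : 0 <= p -> 0 <= x -> 0 <= y ->
  (x + y) `^ p <= 2 `^ p * (x `^ p + y `^ p).
Proof.
move=> p0; wlog xy : x y / x <= y => [H x0 y0|x0 y0].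
  have [/H|/ltW/H] := leP x y; first exact.
  by rewrite addrC [x `^ _ + _]addrC; exact.
apply: (@le_trans _ _ ((2 * y) `^ p)).
  by apply: ge0_ler_powR; rewrite ?nnegrE//; lra.
by rewrite powRM// ler_wpM2l ?powR_ge0// lerDr powR_ge0.
Qed.

(** * Dominated convergence of the derivative *)

Lemma cvg_Rintegral_lp_deriv {R : realType} {p : R} {mu : borel_measure R}
    (p1 : 1 < p) (hLp : forall f, poly_in_Lp p mu f) (f g : {poly R[i]}) :
  \int[mu]_x lp_deriv p (evalR (f + (harmonic j)%:C *: g) x) (evalR g x)
    @[j --> \oo] --> \int[mu]_x lp_deriv p (evalR f x) (evalR g x).
Proof.
have iN := integrable_powR_normc p1 hLp.
have p0 : 0 <= p by lra.
pose N (h : {poly R[i]}) x := normc (evalR h x) `^ p.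
(* As 0 < t = 1/(j+1) <= 1, |f + tg|^p is at most 2^p (|f|^p + |g|^p); the last summand comes from
   the direction g. *)
pose G : measurableTypeR R -> \bar R :=
  EFin \o (fun x => 2 `^ p * (N f x + N g x) + N g x).
have iG : mu.-integrable [set: measurableTypeR R] G.
  exact: (integrableD measurableT (integrableZl measurableT (2 `^ p)
    (integrableD measurableT (iN f) (iN g))) (iN g)).
have [] := @dominated_convergence _ _ _ mu _ measurableT
  (fun j => EFin \o (fun x =>
     lp_deriv p (evalR (f + (harmonic j)%:C *: g) x) (evalR g x)))
  (EFin \o (fun x => lp_deriv p (evalR f x) (evalR g x))) G.
- by move=> j; apply/measurable_EFinP; exact: measurable_lp_deriv.
- by apply/measurable_EFinP; exact: measurable_lp_deriv.
- apply/aeW => x _; apply: cvg_EFin; first exact: nearW.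
  under [X in X @ _]funext do rewrite /= evalRD evalRZ.
  apply: (cvg_at_rightP _ _ _).1 (lp_deriv_cvg p1 (evalR f x) (evalR g x)) _ _.
  by split; [exact: harmonic_gt0|exact: cvg_harmonic].
- exact: iG.
- apply/aeW => x j _; rewrite /= lee_fin.
  rewrite (le_trans (lp_deriv_leD p1 _ _))// lerD2r evalRD evalRZ.
  apply: le_trans _ (powRD_le p0 (normc_ge0 _) (normc_ge0 _)).
  apply: ge0_ler_powR; rewrite ?nnegrE ?addr_ge0 ?normc_ge0//.
  rewrite (le_trans (le_normcD _ _))// lerD2l normcZ ger0_norm ?harmonic_ge0//.
  by rewrite ler_piMl ?normc_ge0// invf_le1 ?ltr0Sn// ler1n.
move=> _ _ h; apply: fine_cvg.
rewrite fineK//; apply: integrable_fin_num => //; exact: integrable_lp_deriv.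
Qed.

(** * Polynomials vanishing almost everywhere *)

(** The set where f is nonzero is open and null, so it misses the support: f has infinitely many
    roots. *)
Lemma negligible_evalR_eq0 {R : realType} {mu : borel_measure R}
    (hsupp : infinite_set (measure_support mu)) (f : {poly R[i]}) :
  mu.-negligible [set x : measurableTypeR R | evalR f x != 0] -> f = 0.
Proof.
move=> Nf.
have [f1 [f2 fE]] := evalR_reim f.
pose U := [set x : R | evalR f x != 0].
have oU : open U.
  (* On the real line |f|^2 is a polynomial with real coefficients, hence continuous. *)
  have -> : U = horner (f1 ^+ 2 + f2 ^+ 2) @^-1` [set y | y != 0].
    rewrite /U; apply/seteqP; split => x /=;
      rewrite -normc_eq0 fE /= sqrtr_eq0 -ltNge !hornerE => h.
      by rewrite gt_eqF.
    by rewrite lt_def h addr_ge0 ?sqr_ge0.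
  apply: open_comp; last exact: open_neq.
  by move=> x _; exact: continuous_horner.
have mU0 : mu U = 0.
  by move/negligibleP : Nf => -> //; exact: open_measurable.
have supp0 : measure_support mu `<=` [set x | root f x%:C].
  move=> x sx; apply: contrapT => /= /negP fx.
  by have := sx _ oU fx; rewrite mU0 ltxx.
(* A nonzero f has fewer than [size f] roots, so [size f] support points suffice. *)
have [B Bs Bn] := infinite_set_fset (size f) hsupp.
apply/eqP; apply: contraPT isT => f0.
have := max_poly_roots f0 (rs := [seq x%:C | x <- finmap.enum_fset B]).
rewrite size_map ltnNge Bn => H.
suff: false by []; apply: H.
  by apply/allP => _ /mapP[x xB ->]; apply: supp0; apply: Bs.
by rewrite map_inj_uniq ?finmap.fset_uniq//; exact: complexI.
Qed.

(** * The p-th power of the Sobolev norm and its derivative *)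

Definition sobolev_pow {R : realType} {m : nat} (p : R)
    (mu : 'I_m.+1 -> borel_measure R) (f : {poly R[i]}) : R :=
  \sum_(k < m.+1) \int[mu k]_x (normc (evalR (derivn k f) x) `^ p).

(** Up to the factor p, the derivative of [sobolev_pow] at [f] in the direction [g]. *)
Definition sobolev_deriv {R : realType} {m : nat} (p : R)
    (mu : 'I_m.+1 -> borel_measure R) (f g : {poly R[i]}) : R :=
  \sum_(k < m.+1)
    \int[mu k]_x lp_deriv p (evalR (derivn k f) x) (evalR (derivn k g) x).

(** The outer p-th root is strictly increasing on nonnegative reals. *)
Lemma sobolev_norm_le {R : realType} {m : nat} {p : R}
    (mu : 'I_m.+1 -> borel_measure R) (p0 : 0 < p) (f g : {poly R[i]}) :
  (sobolev_norm p mu f <= sobolev_norm p mu g) =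
  (sobolev_pow p mu f <= sobolev_pow p mu g).
Proof.
have pow0 h : sobolev_pow p mu h \in Num.nneg.
  rewrite nnegrE sumr_ge0// => k _.
  by apply: Rintegral_ge0 => x _; exact: powR_ge0.
have normE h : sobolev_norm p mu h = sobolev_pow p mu h `^ p^-1 by [].
rewrite !normE; move: (pow0 f) (pow0 g) => {pow0 normE}.
move: (sobolev_pow p mu f) (sobolev_pow p mu g) => x y x0 y0.
have pV0 : 0 < p^-1 by rewrite invr_gt0.
apply/idP/idP => [|xy]; last by apply: ge0_ler_powR => //; exact: ltW.
rewrite leNgt [in X in _ -> X]leNgt; apply: contra => yx.
exact: gt0_ltr_powR.
Qed.

Lemma sobolev_tangent {R : realType} {m : nat} {p : R}
    {mu : 'I_m.+1 -> borel_measure R} (p1 : 1 < p)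
    (hLp : forall k f, poly_in_Lp p (mu k) f) (f g : {poly R[i]}) :
  sobolev_pow p mu f + p * sobolev_deriv p mu f g <= sobolev_pow p mu (f + g).
Proof.
rewrite mulr_sumr -big_split; apply: ler_sum => k _ /=.
by rewrite derivnD; exact: Rintegral_lp_tangent.
Qed.

(** The defects of the tangent inequality are nonnegative for each k and sum to 0, so the one for k
    = 0 vanishes, where the support is infinite. *)
Lemma sobolev_tangent_eq {R : realType} {m : nat} {p : R}
    {mu : 'I_m.+1 -> borel_measure R} (p1 : 1 < p)
    (hsupp : infinite_set (measure_support (mu ord0)))
    (hLp : forall k f, poly_in_Lp p (mu k) f) (f g : {poly R[i]}) :
  sobolev_pow p mu (f + g) = sobolev_pow p mu f + p * sobolev_deriv p mu f g ->
  g = 0.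
Proof.
rewrite /sobolev_deriv mulr_sumr -big_split => /eqP.
rewrite -subr_eq0 -sumrB => /eqP /psumr_eq0P.
have ge0 (k : 'I_m.+1) : true -> 0 <=
  \int[mu k]_x (normc (evalR (derivn k (f + g)) x) `^ p) -
  (\int[mu k]_x (normc (evalR (derivn k f) x) `^ p) +
   p * \int[mu k]_x lp_deriv p (evalR (derivn k f) x) (evalR (derivn k g) x)).
  by move=> _; rewrite subr_ge0 derivnD Rintegral_lp_tangent.
move=> /(_ ge0 ord0 isT)/eqP; rewrite subr_eq0 => /eqP.
rewrite !derivn0 => /(Rintegral_lp_tangent_eq p1 (hLp ord0)).
exact: negligible_evalR_eq0.
Qed.

Lemma cvg_sobolev_deriv {R : realType} {m : nat} {p : R}
    {mu : 'I_m.+1 -> borel_measure R} (p1 : 1 < p)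
    (hLp : forall k f, poly_in_Lp p (mu k) f) (f g : {poly R[i]}) :
  sobolev_deriv p mu (f + (harmonic j)%:C *: g) g @[j --> \oo] -->
  sobolev_deriv p mu f g.
Proof.
apply: cvg_big => // [|k _]; first exact: add_continuous.
under eq_fun do rewrite derivnD derivnZ.
exact: cvg_Rintegral_lp_deriv.
Qed.

Lemma sobolev_derivZ {R : realType} {m : nat} {p : R}
    {mu : 'I_m.+1 -> borel_measure R} (p1 : 1 < p)
    (hLp : forall k f, poly_in_Lp p (mu k) f) (t : R) (f g : {poly R[i]}) :
  sobolev_deriv p mu f (t%:C *: g) = t * sobolev_deriv p mu f g.
Proof.
rewrite /sobolev_deriv mulr_sumr; apply: eq_bigr => k _.
rewrite -RintegralZl//; last exact: integrable_lp_deriv.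
by apply: eq_Rintegral => x _; rewrite derivnZ evalRZ lp_derivZ.
Qed.

(** Conjugating the direction cancels the conjugate in [lp_deriv]; the imaginary part arises from Im
    z = Re (-iz). *)
Lemma sobolev_orthogonality {R : realType} {m : nat} (p : R)
    (mu : 'I_m.+1 -> borel_measure R) (L Q : {poly R[i]}) :
  \sum_(k < m.+1) Cintegral (mu k) (fun x : R =>
      evalR (derivn k Q) x * csgn (evalR (derivn k L) x)
      * (normc (evalR (derivn k L) x) `^ (p - 1))%:C) =
  sobolev_deriv p mu L (map_poly conjc Q) +i*
  sobolev_deriv p mu L (map_poly conjc ((- 'i) *: Q)).
Proof.
have sumC (F G : 'I_m.+1 -> R) :
    \sum_(k < m.+1) (F k +i* G k) = (\sum_k F k) +i* (\sum_k G k).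
  by elim/big_rec3: _ => // k x y z _ ->; simpc.
rewrite sumC; congr (_ +i* _); apply: eq_bigr => k _;
  apply: eq_Rintegral => x _; rewrite -Re_csgn derivn_map evalR_conj conjcK//.
rewrite derivnZ evalRZ.
move: (evalR _ x) (csgn _) (normc _ `^ _) => [a b] [c d] e.
by simpc => /=; ring.
Qed.

(** * Monic competitors and the characterization of the minimizer *)

Lemma monic_of_degreeD {R : realType} {n : nat} {L Q : {poly R[i]}} :
  monic_of_degree n L -> (size Q <= n)%N -> monic_of_degree n (L + Q).
Proof.
move=> [/monicP lL sL] sQ; have QL : (size Q < size L)%N by rewrite sL ltnS.
by split; [apply/monicP; rewrite lead_coefDl|rewrite size_polyDl].
Qed.

Lemma size_monicB {R : realType} {n : nat} {L Q : {poly R[i]}} :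
  monic_of_degree n L -> monic_of_degree n Q -> (size (Q - L)%R <= n)%N.
Proof.
move=> [/monicP lL sL] [/monicP lQ sQ]; apply/leq_sizeP => j.
rewrite leq_eqVlt coefB => /predU1P[<-|nj].
  by move: lL lQ; rewrite !lead_coefE sL sQ /= => -> ->; rewrite subrr.
by rewrite !nth_default ?subrr// (sL, sQ).
Qed.

Theorem theorem4 (R : realType) (m : nat) (p : R)
    (mu : 'I_m.+1 -> borel_measure R) (n : nat) (L : {poly R[i]})
    (hp : 1 < p)
    (hsupp : infinite_set (measure_support (mu ord0)))
    (hLp : forall (k : 'I_m.+1) (f : {poly R[i]}), poly_in_Lp p (mu k) f)
    (hL : monic_of_degree n L) :
  monic_extremal p mu n L <->
  (forall Q : {poly R[i]}, (size Q <= n)%N ->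
    \sum_(k < m.+1)
      Cintegral (mu k) (fun x : R =>
        evalR (derivn k Q) x * csgn (evalR (derivn k L) x)
        * (normc (evalR (derivn k L) x) `^ (p - 1))%:C) = 0).
Proof.
have p0 : 0 < p by lra.
split=> [[[_ Lmin] _] Q sQ|orth].
  have deriv_ge0 (P : {poly R[i]}) : (size P <= n)%N ->
      0 <= sobolev_deriv p mu L P.
    (* The derivative at L is a limit of derivatives at L + tP with t = 1/(j+1), so nonnegativity of
       the latter suffices. *)
    move=> sP; have cL := cvg_sobolev_deriv hp hLp L P.
    rewrite -(cvg_lim (@Rhausdorff R) cL).
    apply: limr_ge; first by apply/cvg_ex; eexists; exact: cL.
    apply: nearW => j.
    set t : R := harmonic j; have t0 : 0 < t := harmonic_gt0 j.
    have sN c : (size (c *: P)%R <= n)%N := leq_trans (size_scale_leq c P) sP.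
    have := Lmin _ (monic_of_degreeD hL (sN t%:C)).
    rewrite (sobolev_norm_le mu p0) => Lle.
    (* The tangent at L + tP in the direction -tP leads back to L, whose value is minimal; hence the
       derivative along -tP is at most 0. *)
    have := sobolev_tangent hp hLp (L + t%:C *: P) ((- t)%:C *: P).
    rewrite sobolev_derivZ// -addrA -scalerDl -rmorphD subrr scale0r addr0 => h.
    have pt0 : 0 < p * t by rewrite mulr_gt0.
    rewrite -(pmulr_rge0 _ pt0); move: Lle h.
    move: (sobolev_pow p mu L) (sobolev_pow p mu (L + _)).
    by move: (sobolev_deriv p mu _ P) => d x y; lra.
  have deriv_eq0 (P : {poly R[i]}) : (size P <= n)%N ->
      sobolev_deriv p mu L P = 0.
    (* The reverse inequality comes from the direction -P. *)
    move=> sP; apply/eqP; rewrite eq_le deriv_ge0// andbT -oppr_ge0.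
    rewrite -mulN1r -(sobolev_derivZ hp hLp) deriv_ge0//.
    exact: leq_trans (size_scale_leq _ _) sP.
  rewrite sobolev_orthogonality !deriv_eq0// (leq_trans (size_poly _ _))//.
  exact: leq_trans (size_scale_leq _ _) sQ.
have deriv_eq0 (P : {poly R[i]}) : (size P <= n)%N ->
    sobolev_deriv p mu L P = 0.
  (* Testing with the conjugate of P, the real part of the relation is the derivative along P. *)
  move=> sP; have := orth (map_poly conjc P) (leq_trans (size_poly _ _) sP).
  rewrite sobolev_orthogonality => -[+ _].
  rewrite -map_poly_comp (eq_map_poly (g := id)) ?map_poly_id// => x.
  exact: conjcK.
have L_le Q : monic_of_degree n Q -> sobolev_pow p mu L <= sobolev_pow p mu Q.
  move=> hQ; have := sobolev_tangent hp hLp L (Q - L).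
  by rewrite (deriv_eq0 _ (size_monicB hL hQ)) mulr0 addr0 subrKC.
split=> [|Q [hQ Qmin]].
  split=> [|Q hQ]; first exact: hL.
  by rewrite (sobolev_norm_le mu p0) (L_le _ hQ).
have := Qmin L hL; rewrite (sobolev_norm_le mu p0) => QL.
apply/esym/eqP; rewrite -subr_eq0; apply/eqP.
(* Q and L have the same value and the derivative along Q - L is 0, so the tangent inequality from L
   to Q is an equality. *)
apply: (sobolev_tangent_eq hp hsupp hLp L).
rewrite (deriv_eq0 _ (size_monicB hL hQ)) mulr0 addr0 subrKC.
by apply/eqP; rewrite eq_le QL (L_le _ hQ).
Qed.
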